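(* Fix $\lambda>0$. The optimal recursive multi-round self-distillation risks are monotone (weakly) decreasing in the number of rounds: $$R_{k+1}(\lambda)\le R_k(\lambda)\quad\text{for all }k\ge0.$$ Moreover, for any $k\ge 0$ with $D_k(\lambda)>0$, $$\xi^\star_{k+1}(\lambda)=-\frac{\lambda}{2}\,\frac{R_k'(\lambda)}{D_k(\lambda)},\qquad R_{k+1}(\lambda)=R_k(\lambda)-\frac{\lambda^2}{4}\,\frac{(R_k'(\lambda))^2}{D_k(\lambda)},$$ where $R_k'(\lambda)$ is the derivative, along the ridge path (with respect to the ridge penalty), of the risk of the round-$k$ teacher with the labels $y^{(k)}$ held fixed. Thus, if $R_k'(\lambda)\ne0$, then $R_{k+1}(\lambda)<R_k(\lambda)$ and $\operatorname{sign}(\xi^\star_{k+1}(\lambda))=-\operatorname{sign}(R_k'(\lambda))$.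
   Context: Let $\mathcal D=(X,y)$ with $X\in\mathbb R^{n\times p}$, $y\in\mathbb R^n$; no distributional assumptions, all statements conditional on $\mathcal D$ (with probability one). For $u\in\mathbb R^n$ and $\ell>0$ let $f_{\ell,u}(x)=x^\top\arg\min_{\beta\in\mathbb R^p}\{\|u-X\beta\|_2^2/n+\ell\|\beta\|_2^2\}$ be the ridge predictor trained on $(X,u)$ with penalty $\ell$. Let $(x_0,y_0)$ be a test pair (possibly out-of-distribution) with $\mathbb E[y_0^2\mid\mathcal D]<\infty$, $\mathbb E[\|x_0\|_2^2\mid\mathcal D]<\infty$, and $R(f)=\mathbb E[(y_0-f(x_0))^2\mid\mathcal D]$. Recursive scheme at fixed $\lambda$: $y^{(0)}=y$. For $k\ge0$: $f^{(k)}_\lambda=f_{\lambda,y^{(k)}}$; $\hat y^{(k)}_\lambda=f^{(k)}_\lambda(X)\in\mathbb R^n$ (fitted values); $f^{(k)}_{\mathrm{pd},\lambda}=f_{\lambda,\hat y^{(k)}_\lambda}$. For $\xi\in\mathbb R$, the round-$(k+1)$ self-distilled predictor is $$f^{(k+1)}_{\mathrm{sd},\lambda,\xi}(x)=x^\top\arg\min_\beta\{(1-\xi)\|y^{(k)}-X\beta\|_2^2/n+\xi\|\hat y^{(k)}_\lambda-X\beta\|_2^2/n+\lambda\|\beta\|_2^2\},$$ which equals the ridge predictor trained on $(1-\xi)y^{(k)}+\xi\hat y^{(k)}_\lambda$. Let $\xi^\star_{k+1}(\lambda)\in\arg\min_{\xi\in\mathbb R}R(f^{(k+1)}_{\mathrm{sd},\lambda,\xi})$,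 $y^{(k+1)}=(1-\xi^\star_{k+1}(\lambda))y^{(k)}+\xi^\star_{k+1}(\lambda)\hat y^{(k)}_\lambda$, and $f^{(k+1)}_\lambda=f^{(k+1)}_{\mathrm{sd},\lambda,\xi^\star_{k+1}(\lambda)}$. $R_k(\lambda)=R(f^{(k)}_\lambda)$ and $D_k(\lambda)=\mathbb E[(f^{(k)}_\lambda(x_0)-f^{(k)}_{\mathrm{pd},\lambda}(x_0))^2\mid\mathcal D]$. Precisely, $R_k'(\lambda)=\frac{d}{d\ell}R(f_{\ell,y^{(k)}})\big|_{\ell=\lambda}$ with $y^{(k)}$ (constructed at the given $\lambda$) held fixed. *)

(* Defs.v *)
From HB Require Import structures.
From mathcomp Require Import all_boot all_order all_algebra.
From mathcomp Require Import all_classical all_reals all_analysis.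
From mathcomp Require Import ring.

Set Implicit Arguments.
Unset Strict Implicit.
Unset Printing Implicit Defensive.

Import Order.TTheory GRing.Theory Num.Theory.
Import numFieldNormedType.Exports.

Local Open Scope classical_set_scope.
Local Open Scope ring_scope.

Definition argmins (R : realType) (A : Type) (g : A -> R) : set A :=
  [set a | forall b, g a <= g b].

(* Squared Euclidean norm; the library's norm on matrices is the sup norm. *)
Definition sqnorm (R : realType) (m : nat) (v : 'cV[R]_m) : R :=
  \sum_i v i 0 ^+ 2.

Section ridge.
Context {R : realType} {n p : nat}.
Implicit Types (X : 'M[R]_(n, p)) (u yk : 'cV[R]_n) (l xi : R).
Implicit Types (f : 'cV[R]_p -> R) (b : 'cV[R]_p).

(* A ridge-type objective with a positive penalty has exactly one minimizer,
   so the default value 0 only shows up for nonpositive penalties. *)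
Definition argmin (g : 'cV[R]_p -> R) : 'cV[R]_p := xget 0 (argmins g).

Definition linpred b : 'cV[R]_p -> R := fun x => (x^T *m b) 0 0.

Definition ridge_obj X l u b : R :=
  sqnorm (u - X *m b) / n%:R + l * sqnorm b.

Definition ridge X l u : 'cV[R]_p -> R := linpred (argmin (ridge_obj X l u)).

Definition fitted X f : 'cV[R]_n := \col_i f (row i X)^T.

Definition pd_ridge X l u : 'cV[R]_p -> R := ridge X l (fitted X (ridge X l u)).

Definition sd_obj X l u xi b : R :=
  (1 - xi) * (sqnorm (u - X *m b) / n%:R)
  + xi * (sqnorm (fitted X (ridge X l u) - X *m b) / n%:R)
  + l * sqnorm b.

Definition sd_ridge X l u xi : 'cV[R]_p -> R :=
  linpred (argmin (sd_obj X l u xi)).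

Definition mixed_labels X l u xi : 'cV[R]_n :=
  (1 - xi) *: u + xi *: fitted X (ridge X l u).

Lemma sd_ridgeE X l u xi : sd_ridge X l u xi = ridge X l (mixed_labels X l u xi).
Proof.
rewrite /sd_ridge /ridge; congr (linpred (xget 0 _)).
pose z := fitted X (ridge X l u).
pose c := (1 - xi) * xi * sqnorm (u - z) / n%:R.
have E b : sd_obj X l u xi b = ridge_obj X l (mixed_labels X l u xi) b + c.
  rewrite /sd_obj /ridge_obj /c /mixed_labels -/z.
  rewrite !mulrA -[RHS]addrA [l * _ + _]addrC addrA -!mulrDl; congr (_ / _ + _).
  rewrite /sqnorm !mulr_sumr -!big_split /=; apply: eq_bigr => i _.
  by rewrite !mxE; ring.
apply/seteqP; split=> b /= H b'; have := H b'; rewrite !E.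
  by rewrite lerD2r.
by rewrite lerD2r.
Qed.

(* [xi k.+1] is the mixing weight of round k.+1; [xi 0] is not used. *)
Fixpoint round_labels X (y : 'cV[R]_n) l (xi : nat -> R) (k : nat) : 'cV[R]_n :=
  if k is j.+1
  then mixed_labels X l (round_labels X y l xi j) (xi j.+1)
  else y.

Definition round_ridge X (y : 'cV[R]_n) l (xi : nat -> R) (k : nat) :
  'cV[R]_p -> R := ridge X l (round_labels X y l xi k).

Lemma round_ridgeS X y l (xi : nat -> R) k :
  round_ridge X y l xi k.+1 = sd_ridge X l (round_labels X y l xi k) (xi k.+1).
Proof. by rewrite sd_ridgeE. Qed.

End ridge.

(* The data (X, y) are fixed; P governs the test pair (x0, y0) and stands for
   its conditional distribution given the data. *)
Section risk.
Context {R : realType} {p : nat} {d : measure_display} {T : measurableType d}.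
Variable P : probability T R.
Variable x0 : 'I_p -> {RV P >-> R}.
Variable y0 : {RV P >-> R}.
Implicit Types f g : 'cV[R]_p -> R.

Definition test_point (w : T) : 'cV[R]_p := \col_i x0 i w.

Definition risk f : R :=
  fine 'E_P[fun w => ((y0 w - f (test_point w)) ^+ 2)%R].

Definition disagreement f g : R :=
  fine 'E_P[fun w => ((f (test_point w) - g (test_point w)) ^+ 2)%R].

Section rounds.
Context {n : nat}.
Variables (X : 'M[R]_(n, p)) (y : 'cV[R]_n) (l : R) (xi : nat -> R).

Definition optimal_weights : Prop := forall k,
  argmins (fun t => risk (sd_ridge X l (round_labels X y l xi k) t)) (xi k.+1).

Definition round_risk k : R := risk (round_ridge X y l xi k).

Definition round_gap k : R :=
  disagreement (round_ridge X y l xi k)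
               (pd_ridge X l (round_labels X y l xi k)).

(* The labels stay those built with penalty l while the ridge penalty varies. *)
Definition path_risk k : R -> R :=
  fun l' => risk (ridge X l' (round_labels X y l xi k)).

End rounds.
End risk.

(* Main.v *)
Require Import Defs.
From HB Require Import structures.
From mathcomp Require Import all_boot all_order all_algebra.
From mathcomp Require Import all_classical all_reals all_analysis.
From mathcomp Require Import measurable_realfun.
From mathcomp Require Import ring lra.

(** Why the theorem holds.  For a fixed label vector [u] and penalty [a], write
    [A l = X^T X + n l I] and [b = (A a)^-1 X^T u] for the ridge coefficients.
    Put [v l = n (A l)^-1 b].  At penalty [a], the ridge path and distillation
    both move the coefficients along [v a]:
    - the coefficients at penalty [l] are [b - (l - a) v l], the resolvent
      identity ([ridge_coef_path]);
    - the coefficients of the student with mixing weight [t], whose case [t = 1]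
      is the pure-distillation predictor, are [b - t a v a], because shrinking
      the fitted values once more removes [n a (A a)^-1 b]
      ([ridge_coef_mixed]).

    Risk and disagreement are values of one quadratic form, that of the Gram
    matrix of the test pair, which is finite by the second-moment hypotheses
    ([risk_linpred], [disagreement_linpred]).  Let [c] be half the derivative of
    the risk along [- v a].  The path risk has derivative [2 c] at [a]
    ([is_derive_path_risk]), while the student risk is
    [R + 2 t (a c) + t^2 D] with [D] the disagreement between teacher and
    pure-distillation predictor ([risk_sd_ridge], [disagreement_pd_ridge]).

    An optimal weight [x] is thus a minimizer of a real quadratic polynomial
    with linear coefficient [a R'], so [a R' / 2 = - x D] with [0 <= D]
    ([quad_argmin]), and the minimum is [R - x^2 D].  Everything claimed is read
    off from these relations; in particular [R' != 0] forces [D > 0], since a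
    linear nonconstant polynomial has no minimizer. *)

Set Implicit Arguments.
Unset Strict Implicit.
Unset Printing Implicit Defensive.

Import Order.TTheory GRing.Theory Num.Theory.
Import numFieldNormedType.Exports.

Local Open Scope classical_set_scope.
Local Open Scope ring_scope.

(** * Entrywise limits of matrices *)

Section matrix_limits.
Context {R : realType} {T : Type} {F : set_system T} {FF : Filter F}.

Definition mx_cvg (m n : nat) (A : T -> 'M[R]_(m, n)) (B : 'M[R]_(m, n)) :=
  forall i j, A x i j @[x --> F] --> B i j.

Lemma mx_cvg_cst m n (B : 'M[R]_(m, n)) : mx_cvg (fun=> B) B.
Proof. by move=> i j; exact: cvg_cst. Qed.

Lemma mx_cvgM m n p (A : T -> 'M[R]_(m, n)) (B : T -> 'M[R]_(n, p)) A0 B0 :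
  mx_cvg A A0 -> mx_cvg B B0 -> mx_cvg (fun x => A x *m B x) (A0 *m B0).
Proof.
move=> cA cB i j; rewrite mxE.
rewrite (eq_cvg _ _ (g := fun x => \sum_k A x i k * B x k j)); last first.
  by move=> x; rewrite mxE.
apply: (cvg_big (@add_continuous R)) => k _.
exact: cvgM.
Qed.

Lemma mx_cvg_tr m n (A : T -> 'M[R]_(m, n)) A0 :
  mx_cvg A A0 -> mx_cvg (fun x => (A x)^T) A0^T.
Proof.
move=> cA i j; rewrite mxE (eq_cvg _ _ (g := fun x => A x j i)) // => x.
by rewrite mxE.
Qed.

Lemma mx_cvg_det n (A : T -> 'M[R]_n) A0 :
  mx_cvg A A0 -> \det (A x) @[x --> F] --> \det A0.
Proof.
move=> cA; apply: (cvg_big (@add_continuous R)) => s _.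
apply: cvgM; first exact: cvg_cst.
apply: (cvg_big (@mul_continuous R)) => i _.
exact: cA.
Qed.

Lemma mx_cvg_adj n (A : T -> 'M[R]_n) A0 :
  mx_cvg A A0 -> mx_cvg (fun x => \adj (A x)) (\adj A0).
Proof.
move=> cA i j; rewrite mxE.
rewrite (eq_cvg _ _ (g := fun x => cofactor (A x) j i)); last first.
  by move=> x; rewrite mxE.
apply: cvgM; first exact: cvg_cst.
apply: mx_cvg_det => k l; rewrite !mxE.
rewrite (eq_cvg _ _ (g := fun x => A x (lift j k) (lift i l))) // => x.
by rewrite !mxE.
Qed.

(** [invmx A] is [A] itself when [A] is singular, so the limit must be
    invertible; the matrices near it then are. *)
Lemma mx_cvg_inv n (A : T -> 'M[R]_n) A0 : A0 \in unitmx ->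
  mx_cvg A A0 -> mx_cvg (fun x => invmx (A x)) (invmx A0).
Proof.
move=> A0u cA i j; have cD := mx_cvg_det cA.
have D0 : \det A0 != 0 by move: A0u; rewrite unitmxE unitfE.
have nD : \forall x \near F, \det (A x) != 0.
  exact: (cvgr_neq0 _ cD D0).
rewrite /invmx A0u mxE.
have : (\det (A x))^-1 * \adj (A x) i j @[x --> F]
         --> (\det A0)^-1 * \adj A0 i j.
  by apply: cvgM; [exact: cvgV | exact: mx_cvg_adj].
apply: cvg_trans; apply: near_eq_cvg.
near=> x.
have Dx : \det (A x) != 0 by near: x; exact: nD.
by rewrite unitmxE unitfE Dx [RHS]mxE.
Unshelve. all: by end_near. Qed.

End matrix_limits.

(** * Derivatives and minima of real functions *)

Section caratheodory.
Context {R : realType}.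

(** Caratheodory's form of the derivative: dividing the increment by [l - a]
    leaves exactly the continuous factor [g]. *)
Lemma is_derive_increment (f g : R -> R) (a : R) :
  (\forall l \near a, f l = f a + (l - a) * g l) -> {for a, continuous g} ->
  is_derive a 1 f (g a).
Proof.
move=> fE gc.
have cf : h^-1 *: ((f \o shift a) (h *: 1) - f a) @[h --> 0^'] --> g a.
  move/continuous_withinNshiftx : gc; apply: cvg_trans; apply: near_eq_cvg.
  have {}fE : \forall h \near 0^', f (h + a) = f a + h * g (h + a).
    apply: nbhs_dnbhs; move/nbhs0P : fE; apply: filterS => h.
    by rewrite [a + h]addrC addrK.
  near=> h; rewrite /= [h *: 1]mulr1.
  have h0 : h != 0 by near: h; exact: nbhs_dnbhs_neq.
  have -> : f (h + a) = f a + h * g (h + a) by near: h; exact: fE.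
  by rewrite [_ - f a]addrC addKr [_ *: _]mulrA mulVf ?mul1r.
by split; [apply/cvg_ex; exists (g a) | exact: cvg_lim cf].
Unshelve. all: by end_near. Qed.

End caratheodory.

Section quadratic_minimum.
Context {R : realType}.

(** Moving by a small step against the slope [2 * c] would decrease the
    polynomial, so the slope vanishes at a minimum. *)
Lemma quad_nonneg (c q : R) :
  (forall t, 0 <= 2 * t * c + t ^+ 2 * q) -> c = 0 /\ 0 <= q.
Proof.
move=> H; have q0 : 0 <= q by have := H 1; have := H (-1); nra.
split => //; apply/eqP; rewrite -sqrf_eq0 eq_le sqr_ge0 andbT.
have q1 : 0 < q + 1 by lra.
(* The minimizer would be [- c / q]; adding 1 avoids a case split on [q = 0]. *)
have := H (- c / (q + 1)).
have -> : 2 * (- c / (q + 1)) * c + (- c / (q + 1)) ^+ 2 * q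
          = - ((q + 2) / (q + 1) ^+ 2 * c ^+ 2) by field; lra.
rewrite oppr_ge0 pmulr_rle0// divr_gt0 ?exprn_gt0//; lra.
Qed.

(** Recentring the polynomial at its minimizer leaves the slope
    [2 * (c + x * q)], which must vanish. *)
Lemma quad_argmin (r c q x : R) :
  argmins (fun t => r + 2 * t * c + t ^+ 2 * q) x -> c = - (x * q) /\ 0 <= q.
Proof.
move=> H; have [] := @quad_nonneg (c + x * q) q.
  by move=> t; have := H (x + t); nra.
by move=> /eqP; rewrite addr_eq0 => /eqP.
Qed.

End quadratic_minimum.

(** * Ridge coefficients along the path and under distillation *)

Section ridge_closed_form.
Context {R : realType} {n p : nat}.
Variable X : 'M[R]_(n, p).

(** The loss is averaged over the [n] observations, which multiplies the penalty
    by [n] in the normal equations. *)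
Definition gram_ridge (l : R) : 'M[R]_p := X^T *m X + (n%:R * l)%:M.

Definition ridge_coef (l : R) (u : 'cV[R]_n) : 'cV[R]_p :=
  invmx (gram_ridge l) *m (X^T *m u).

Lemma sqnormE m (v : 'cV[R]_m) : sqnorm v = (v^T *m v) 0 0.
Proof. by rewrite mxE; apply: eq_bigr => i _; rewrite mxE expr2. Qed.

Lemma sqnorm_ge0 m (v : 'cV[R]_m) : 0 <= sqnorm v.
Proof. by apply: sumr_ge0 => i _; exact: sqr_ge0. Qed.

Lemma sqnorm_eq0 m (v : 'cV[R]_m) : sqnorm v = 0 -> v = 0.
Proof.
move=> /eqP; rewrite psumr_eq0; last by move=> i _; exact: sqr_ge0.
move=> /allP H; apply/matrixP => i j; rewrite ord1 mxE.
by apply/eqP; rewrite -sqrf_eq0; apply: H; rewrite mem_index_enum.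
Qed.

Lemma sqnormD m (v w : 'cV[R]_m) :
  sqnorm (v + w) = sqnorm v + 2 * (w^T *m v) 0 0 + sqnorm w.
Proof.
rewrite mxE mulr_sumr -!big_split /=; apply: eq_bigr => i _.
by rewrite !mxE; ring.
Qed.

Hypothesis n_gt0 : (0 < n)%N.

(** Positive definiteness: [v A v^T = |X v^T|^2 + n l |v|^2]. *)
Lemma gram_ridge_unit (l : R) : 0 < l -> gram_ridge l \in unitmx.
Proof.
move=> l0; rewrite -row_free_unit; apply: inj_row_free => v vA0.
have nl : 0 < n%:R * l by rewrite mulr_gt0// ltr0n.
have E : v *m gram_ridge l *m v^T =
    (X *m v^T)^T *m (X *m v^T) + (n%:R * l) *: ((v^T)^T *m v^T).
  by rewrite trmx_mul trmxK mulmxDr mulmxDl mul_mx_scalar -scalemxAl !mulmxA.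
have /eqP : sqnorm (X *m v^T) + n%:R * l * sqnorm v^T = 0.
  have := congr1 (fun M : 'M[R]_1 => M 0 0) E.
  by rewrite vA0 mul0mx mxE !sqnormE => /esym; rewrite mxE [X in _ + X]mxE.
rewrite paddr_eq0 ?(mulr_ge0 (ltW nl)) ?sqnorm_ge0//.
move=> /andP[_]; rewrite mulf_eq0 gt_eqF//= => /eqP /sqnorm_eq0.
by move=> /(congr1 trmx); rewrite trmxK trmx0.
Qed.

Lemma ridge_coefP (l : R) u : 0 < l ->
  gram_ridge l *m ridge_coef l u = X^T *m u.
Proof. by move=> l0; rewrite mulKVmx// gram_ridge_unit. Qed.

(** Completing the square: the cross term vanishes by the normal equations. *)
Lemma ridge_obj_square (l : R) u (e : 'cV[R]_p) : 0 < l ->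
  ridge_obj X l u (ridge_coef l u + e) =
    ridge_obj X l u (ridge_coef l u)
    + (sqnorm (X *m e) / n%:R + l * sqnorm e).
Proof.
move=> l0; move: (ridge_coef l u) (ridge_coefP u l0) => b bP.
have n0 : n%:R != 0 :> R by rewrite pnatr_eq0 -lt0n.
have nE : X^T *m (u - X *m b) = (n%:R * l) *: b.
  rewrite mulmxBr -bP mulmxDl mul_scalar_mx mulmxA.
  by rewrite addrAC subrr add0r.
rewrite /ridge_obj mulmxDr opprD addrA (sqnormD (u - X *m b)) (sqnormD b).
have -> : sqnorm (- (X *m e)) = sqnorm (X *m e).
  by apply: eq_bigr => i _; rewrite mxE sqrrN.
have -> : (- (X *m e))^T *m (u - X *m b) = - ((n%:R * l) *: (e^T *m b)).
  by rewrite linearN /= mulNmx trmx_mul -mulmxA nE -scalemxAr.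
by rewrite 2!mxE; field.
Qed.

(** By [ridge_obj_square] the objective exceeds its value at [ridge_coef l u] by
    at least [l * sqnorm e], so the minimizer is unique and the chosen one. *)
Lemma ridgeE (l : R) u : 0 < l -> ridge X l u = linpred (ridge_coef l u).
Proof.
move=> l0; congr linpred; apply: xget_unique => [b|b Hb].
  rewrite -[b in leRHS](subrK (ridge_coef l u)) [in leRHS]addrC.
  rewrite ridge_obj_square// lerDl addr_ge0// ?mulr_ge0 ?sqnorm_ge0//.
  exact: ltW.
apply/eqP; rewrite -subr_eq0; apply/eqP/sqnorm_eq0/eqP.
rewrite eq_le sqnorm_ge0 andbT -(pmulr_rle0 _ l0).
have := Hb (ridge_coef l u).
rewrite -[b in leLHS](subrK (ridge_coef l u)) [in leLHS]addrC.
rewrite ridge_obj_square// gerDl; apply: le_trans.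
by rewrite lerDr mulr_ge0 ?sqnorm_ge0// invr_ge0.
Qed.

Lemma fitted_ridge (l : R) u : 0 < l ->
  fitted X (ridge X l u) = X *m ridge_coef l u.
Proof.
move=> l0; apply/matrixP => i j; rewrite ridgeE// mxE /linpred trmxK.
by rewrite -row_mul mxE ord1.
Qed.

(** The opposite of the difference quotient of the coefficients between the
    penalties [a] and [l], and of their derivative when [l = a]. *)
Definition path_dir (a l : R) (u : 'cV[R]_n) : 'cV[R]_p :=
  n%:R *: (invmx (gram_ridge l) *m ridge_coef a u).

(** The resolvent identity: apply [gram_ridge l] to both sides. *)
Lemma ridge_coef_path (a l : R) u : 0 < a -> 0 < l ->
  ridge_coef l u = ridge_coef a u - (l - a) *: path_dir a l u.
Proof.
move=> a0 l0; apply: (can_inj (mulKmx (gram_ridge_unit l0))).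
rewrite ridge_coefP// mulmxBr -!scalemxAr mulKVmx ?gram_ridge_unit//.
rewrite -(ridge_coefP u a0) /gram_ridge !mulmxDl !mul_scalar_mx scalerA.
by rewrite -addrA -scalerBl; congr (_ + _ *: _); ring.
Qed.

(** The normal equations turn [X^T] applied to the fitted values into
    [X^T u - n l b], so mixing subtracts [xi * n l b] from the right-hand side
    of the linear system. *)
Lemma ridge_coef_mixed (l xi : R) u : 0 < l ->
  ridge_coef l (mixed_labels X l u xi) =
    ridge_coef l u - (xi * l) *: path_dir l l u.
Proof.
move=> l0; apply: (can_inj (mulKmx (gram_ridge_unit l0))).
rewrite mulmxBr !ridge_coefP// -!scalemxAr mulKVmx ?gram_ridge_unit//.
rewrite /mixed_labels fitted_ridge// mulmxDr -!scalemxAr.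
rewrite [_ *m (X *m _)]mulmxA.
have -> : X^T *m X *m ridge_coef l u =
    X^T *m u - (n%:R * l) *: ridge_coef l u.
  by rewrite -(ridge_coefP u l0) mulmxDl mul_scalar_mx addrK.
rewrite scalerBr addrA -scalerDl subrK scale1r !scalerA.
by congr (_ - _ *: _); ring.
Qed.

End ridge_closed_form.

(** * Second moments of the test pair *)

Section gram_matrix.
Context {R : realType} {d : measure_display} {T : measurableType d}.
Variable P : probability T R.

(** Square-integrability passes to products through [|f g| <= f^2 + g^2]. *)
Lemma integrable_mul_sq (f g : T -> R) :
  measurable_fun setT f -> measurable_fun setT g ->
  P.-integrable setT (EFin \o (fun w => f w ^+ 2)) ->
  P.-integrable setT (EFin \o (fun w => g w ^+ 2)) ->
  P.-integrable setT (EFin \o (fun w => f w * g w)).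
Proof.
move=> mf mg f2 g2.
apply: (le_integrable measurableT _ _ (integrableD measurableT f2 g2)).
  by apply/measurable_EFinP; exact: measurable_funM.
move=> w _; rewrite /= lee_fin [leRHS]ger0_norm ?addr_ge0 ?sqr_ge0//.
rewrite normrM -[f w ^+ 2]real_normK ?num_real//.
rewrite -[g w ^+ 2]real_normK ?num_real//.
by have := sqr_ge0 (`|f w| - `|g w|); have := normr_ge0 (f w);
  have := normr_ge0 (g w); nra.
Qed.

Context {m : nat}.
Variable Z : 'I_m -> T -> R.
Hypothesis mZ : forall i, measurable_fun setT (Z i).
Hypothesis Z2 : forall i, P.-integrable setT (EFin \o (fun w => Z i w ^+ 2)).

Definition gram : 'M[R]_m :=
  \matrix_(i, j) fine (\int[P]_w (Z i w * Z j w)%:E)%E.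

Definition gram_form (z w : 'cV[R]_m) : R := (z^T *m gram *m w) 0 0.

Lemma gram_formE z w :
  gram_form z w = \sum_i \sum_j z i 0 * w j 0 * gram i j.
Proof.
rewrite /gram_form -mulmxA mxE; apply: eq_bigr => i _.
rewrite mxE mxE mulr_sumr; apply: eq_bigr => j _.
by rewrite [gram i j * _]mulrC mulrA.
Qed.

Lemma gram_formC z w : gram_form z w = gram_form w z.
Proof.
rewrite !gram_formE exchange_big /=; apply: eq_bigr => i _.
apply: eq_bigr => j _; rewrite [z j 0 * _]mulrC !mxE; congr (_ * fine _).
by apply: eq_integral => x _; rewrite mulrC.
Qed.

Lemma gram_formD_sq z w (t : R) :
  gram_form (z + t *: w) (z + t *: w) =
    gram_form z z + 2 * t * gram_form z w + t ^+ 2 * gram_form w w.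
Proof.
have -> : gram_form (z + t *: w) (z + t *: w) =
    gram_form z z + t * gram_form z w
      + (t * gram_form w z + t * (t * gram_form w w)).
  rewrite !gram_formE !mulr_sumr -!big_split /=; apply: eq_bigr => i _.
  rewrite !mulr_sumr -!big_split /=; apply: eq_bigr => j _.
  by rewrite !mxE; ring.
by rewrite (gram_formC w z); ring.
Qed.

Lemma expectation_sq_lincomb (z : 'cV[R]_m) :
  fine 'E_P[fun w => (\sum_i z i 0 * Z i w) ^+ 2] = gram_form z z.
Proof.
pose f (k : 'I_m * 'I_m) w : \bar R :=
  ((z k.1 0 * z k.2 0)%:E * (Z k.1 w * Z k.2 w)%:E)%E.
have int_ZZ k : P.-integrable setT (fun w => (Z k.1 w * Z k.2 w)%:E).
  exact: integrable_mul_sq.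
have int_f k : P.-integrable setT (f k) by exact: integrableZl.
rewrite unlock.
under eq_integral => w _.
  rewrite expr2 big_distrlr pair_big /= -sumEFin.
  rewrite (eq_bigr (fun k => f k w)); last first.
    by move=> k _; rewrite /f -EFinM mulrACA.
  over.
rewrite integral_sum// -sum_fine; last first.
  by move=> k _; exact: integrable_fin_num.
rewrite gram_formE pair_big /=; apply: eq_bigr => k _.
rewrite integralZl// fineM//; last exact: integrable_fin_num.
by rewrite mxE.
Qed.

End gram_matrix.

Section test_moments.
Context {R : realType} {p : nat} {d : measure_display} {T : measurableType d}.
Variables (P : probability T R) (x0 : 'I_p -> {RV P >-> R}) (y0 : {RV P >-> R}).
Hypothesis y0_L2 : ('E_P[fun w => (y0 w ^+ 2)%R] < +oo)%E.
Hypothesis x0_L2 : ('E_P[fun w => sqnorm (test_point x0 w)] < +oo)%E.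

(** Stacking the response on top of the covariates makes every prediction
    error one linear combination of the same square-integrable variables, so
    that a single Gram matrix yields both risks and disagreements. *)
Definition test_pair (i : 'I_(1 + p)) (w : T) : R :=
  (col_mx (y0 w)%:M (test_point x0 w) : 'cV[R]_(1 + p)) i 0.

Lemma test_pair_response i w : test_pair (lshift p i) w = y0 w.
Proof. by rewrite /test_pair col_mxEu ord1 mxE. Qed.

Lemma test_pair_covariate i w : test_pair (rshift 1 i) w = x0 i w.
Proof. by rewrite /test_pair col_mxEd mxE. Qed.

Lemma measurable_test_pair i : measurable_fun setT (test_pair i).
Proof.
case: (split_ordP i) => j ->.
  by rewrite (funext (test_pair_response j)); exact: measurable_funPT.
by rewrite (funext (test_pair_covariate j)); exact: measurable_funPT.
Qed.

Lemma integrable_sq_test_pair i :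
  P.-integrable setT (EFin \o (fun w => test_pair i w ^+ 2)).
Proof.
have m2 j : measurable_fun setT (fun w => (test_pair j w ^+ 2)%:E).
  by apply/measurable_EFinP/measurable_funX; exact: measurable_test_pair.
apply/integrableP; split; first exact: m2.
under eq_integral => w _ do rewrite /= ger0_norm ?sqr_ge0//.
case: (split_ordP i) => j ->.
  under eq_integral => w _ do rewrite test_pair_response.
  by move: y0_L2; rewrite unlock.
under eq_integral => w _ do rewrite test_pair_covariate.
move: x0_L2; rewrite unlock; apply: le_lt_trans.
apply: ge0_le_integral => //=.
- by move=> w _; rewrite lee_fin sqr_ge0.
- by apply/measurable_EFinP/measurable_funX; exact: measurable_funPT.
- apply/measurable_EFinP/measurable_sum => k; apply/measurable_funX.
  rewrite (_ : (fun w => _) = x0 k); first exact: measurable_funPT.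
  by apply/funext => w; rewrite mxE.
- move=> w _; rewrite lee_fin /sqnorm (bigD1 j)//= mxE lerDl.
  by apply: sumr_ge0 => k _; exact: sqr_ge0.
Qed.

Definition test_form := gram_form P test_pair.

Lemma risk_linpred b :
  risk x0 y0 (linpred b) =
    test_form (col_mx 1%:M (- b)) (col_mx 1%:M (- b)).
Proof.
rewrite /test_form -expectation_sq_lincomb; last 2 first.
- exact: measurable_test_pair.
- exact: integrable_sq_test_pair.
congr (fine 'E_P[_]); apply/funext => w; congr (_ ^+ 2).
rewrite big_split_ord big_ord1 /= test_pair_response col_mxEu mxE mul1r.
congr (_ + _); rewrite /linpred mxE -sumrN; apply: eq_bigr => i _.
by rewrite test_pair_covariate col_mxEd !mxE mulrC mulNr.
Qed.

Lemma disagreement_linpred b b' :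
  disagreement x0 (linpred b) (linpred b') =
    test_form (col_mx 0 (b - b')) (col_mx 0 (b - b')).
Proof.
rewrite /test_form -expectation_sq_lincomb; last 2 first.
- exact: measurable_test_pair.
- exact: integrable_sq_test_pair.
congr (fine 'E_P[_]); apply/funext => w; congr (_ ^+ 2).
rewrite big_split_ord big_ord1 /= col_mxEu mxE mul0r add0r.
rewrite /linpred !mxE -sumrB; apply: eq_bigr => i _.
by rewrite test_pair_covariate col_mxEd !mxE; ring.
Qed.

End test_moments.

(** * One round of self-distillation *)

Section path_continuity.
Context {R : realType} {n p : nat}.
Variable X : 'M[R]_(n, p).
Hypothesis n_gt0 : (0 < n)%N.

Lemma mx_cvg_path_dir (a : R) u : 0 < a ->
  mx_cvg (path_dir X a ^~ u) (path_dir X a a u) (F := nbhs a).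
Proof.
move=> a0.
have cA : mx_cvg (gram_ridge X) (gram_ridge X a) (F := nbhs a).
  move=> i j; rewrite mxE [X in _ + X]mxE.
  rewrite (eq_cvg _ _ (g := fun l => (X^T *m X) i j + n%:R * l * (i == j)%:R)).
    rewrite -[_ * a *+ _]mulr_natr; apply: cvgD; first exact: cvg_cst.
    apply: cvgM; last exact: cvg_cst.
    by apply: cvgM; [exact: cvg_cst | exact: cvg_id].
  by move=> l; rewrite mxE [X in _ + X]mxE mulr_natr.
have cN : mx_cvg (fun=> n%:R%:M) (n%:R%:M : 'M[R]_p) (F := nbhs a).
  exact: mx_cvg_cst.
have cb : mx_cvg (fun=> ridge_coef X a u) (ridge_coef X a u) (F := nbhs a).
  exact: mx_cvg_cst.
rewrite /path_dir -mul_scalar_mx => i j.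
rewrite (eq_cvg _ _ (g := fun l =>
    (n%:R%:M *m (invmx (gram_ridge X l) *m ridge_coef X a u)) i j)).
  exact: (mx_cvgM cN (mx_cvgM (mx_cvg_inv (gram_ridge_unit X n_gt0 a0) cA) cb)).
by move=> l; rewrite mul_scalar_mx.
Qed.

End path_continuity.

Section one_round.
Context {R : realType} {n p : nat}.
Context {d : measure_display} {T : measurableType d}.
Hypothesis n_gt0 : (0 < n)%N.
Variables (X : 'M[R]_(n, p)).
Variables (P : probability T R) (x0 : 'I_p -> {RV P >-> R}) (y0 : {RV P >-> R}).
Hypothesis y0_L2 : ('E_P[fun w => (y0 w ^+ 2)%R] < +oo)%E.
Hypothesis x0_L2 : ('E_P[fun w => sqnorm (test_point x0 w)] < +oo)%E.
Variables (a : R) (u : 'cV[R]_n).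
Hypothesis a_gt0 : 0 < a.

Local Notation form := (test_form x0 y0).
Let z0 : 'cV[R]_(1 + p) := col_mx 1%:M (- ridge_coef X a u).
Let dir l : 'cV[R]_(1 + p) := col_mx 0 (path_dir X a l u).

Let z0_dir l t :
  z0 + t *: dir l = col_mx 1%:M (- (ridge_coef X a u - t *: path_dir X a l u)).
Proof.
by rewrite /z0 /dir scale_col_mx add_col_mx scaler0 addr0 opprB addrC.
Qed.

(** Half the derivative of the risk along the ridge path, see
    [is_derive_path_risk]. *)
Definition teacher_slope := form z0 (dir a).

Lemma risk_ridge_path l : 0 < l ->
  risk x0 y0 (ridge X l u) = risk x0 y0 (ridge X a u)
    + (l - a) * (2 * form z0 (dir l) + (l - a) * form (dir l) (dir l)).
Proof.
move=> l0; rewrite !ridgeE// !risk_linpred//.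
rewrite (ridge_coef_path X n_gt0 u a_gt0 l0) -z0_dir.
by rewrite /test_form gram_formD_sq -/z0; ring.
Qed.

Lemma risk_sd_ridge t :
  risk x0 y0 (sd_ridge X a u t) = risk x0 y0 (ridge X a u)
    + 2 * t * (a * teacher_slope) + t ^+ 2 * (a ^+ 2 * form (dir a) (dir a)).
Proof.
rewrite sd_ridgeE !ridgeE// !risk_linpred// ridge_coef_mixed//.
by rewrite -z0_dir /teacher_slope /test_form gram_formD_sq -/z0; ring.
Qed.

Lemma disagreement_pd_ridge :
  disagreement x0 (ridge X a u) (pd_ridge X a u) =
    a ^+ 2 * form (dir a) (dir a).
Proof.
(* Pure distillation is the student with mixing weight 1. *)
have -> : pd_ridge X a u = ridge X a (mixed_labels X a u 1).
  by rewrite /pd_ridge /mixed_labels subrr scale0r add0r scale1r.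
rewrite !ridgeE// (disagreement_linpred y0_L2 x0_L2) ridge_coef_mixed// mul1r.
rewrite opprB addrC subrK.
have -> : col_mx 0 (a *: path_dir X a a u) = 0 + a *: dir a.
  by rewrite /dir scale_col_mx scaler0 add0r.
by rewrite /test_form gram_formD_sq /gram_form !(trmx0, mul0mx) !mxE; ring.
Qed.

(** The factor of [l - a] in [risk_ridge_path] is continuous because [path_dir]
    is, so its value at [a] is the derivative. *)
Lemma is_derive_path_risk :
  is_derive a 1 (fun l => risk x0 y0 (ridge X l u)) (2 * teacher_slope).
Proof.
pose g l := 2 * form z0 (dir l) + (l - a) * form (dir l) (dir l).
have -> : 2 * teacher_slope = g a by rewrite /g subrr mul0r addr0.
apply: is_derive_increment.
  near=> l; apply: risk_ridge_path; near: l; exact: (lt_nbhsr a_gt0).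
have c_dir : mx_cvg dir (dir a) (F := nbhs a).
  move=> i j; case: (split_ordP i) => k ->.
    rewrite col_mxEu (eq_cvg _ _ (g := fun=> (0 : 'cV[R]_1) k j)).
      exact: cvg_cst.
    by move=> l; rewrite col_mxEu.
  rewrite col_mxEd (eq_cvg _ _ (g := fun l => path_dir X a l u k j)).
    exact: mx_cvg_path_dir.
  by move=> l; rewrite col_mxEd.
have c_cst m (B : 'M[R]_(m, 1 + p)) : mx_cvg (fun=> B) B (F := nbhs a).
  exact: mx_cvg_cst.
have c_slope : form z0 (dir l) @[l --> a] --> form z0 (dir a).
  exact: (mx_cvgM (c_cst _ _) c_dir).
have c_sq : form (dir l) (dir l) @[l --> a] --> form (dir a) (dir a).
  exact: (mx_cvgM (mx_cvgM (mx_cvg_tr c_dir) (c_cst _ _)) c_dir).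
apply: cvgD; apply: cvgM => //; first exact: cvg_cst.
by apply: cvgB; [exact: cvg_id | exact: cvg_cst].
Unshelve. all: by end_near. Qed.

End one_round.

(** * Monotonicity over the rounds *)

Theorem proposition5p1 (R : realType) (n p : nat) (n_gt0 : (0 < n)%N)
    (X : 'M[R]_(n, p)) (y : 'cV[R]_n)
    (d : measure_display) (T : measurableType d) (P : probability T R)
    (x0 : 'I_p -> {RV P >-> R}) (y0 : {RV P >-> R})
    (y0_L2 : ('E_P[fun w => (y0 w ^+ 2)%R] < +oo)%E)
    (x0_L2 : ('E_P[fun w => sqnorm (test_point x0 w)] < +oo)%E)
    (lambda : R) (lambda_gt0 : 0 < lambda)
    (xi : nat -> R) (xi_opt : optimal_weights x0 y0 X y lambda xi) :
  let Rk := round_risk x0 y0 X y lambda xi in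
  let Dk := round_gap x0 X y lambda xi in
  let Rk' := fun k => derive1 (path_risk x0 y0 X y lambda xi k) lambda in
  [/\ forall k, Rk k.+1 <= Rk k,
      forall k, derivable (path_risk x0 y0 X y lambda xi k) lambda 1,
      forall k, 0 < Dk k ->
        xi k.+1 = - (lambda / 2) * (Rk' k / Dk k) /\
        Rk k.+1 = Rk k - lambda ^+ 2 / 4 * (Rk' k ^+ 2 / Dk k)
    & forall k, Rk' k != 0 ->
        Rk k.+1 < Rk k /\ Num.sg (xi k.+1) = - Num.sg (Rk' k)].
Proof.
move=> Rk Dk Rk'.
have dR k := is_derive_path_risk n_gt0 X y0_L2 x0_L2
  (round_labels X y lambda xi k) lambda_gt0.
have sdE k t : risk x0 y0 (sd_ridge X lambda (round_labels X y lambda xi k) t)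
    = Rk k + 2 * t * (lambda / 2 * Rk' k) + t ^+ 2 * Dk k.
  rewrite /Dk /round_gap /round_ridge (disagreement_pd_ridge _ _ y0_L2)//.
  rewrite risk_sd_ridge//.
  rewrite /Rk' derive1E (@derive_val _ _ _ _ _ _ _ (dR k)).
  by congr (_ + 2 * t * _ + _); field.
have stepP k : [/\ lambda / 2 * Rk' k = - (xi k.+1 * Dk k), 0 <= Dk k &
    Rk k.+1 = Rk k - xi k.+1 ^+ 2 * Dk k].
  have [|cE D0] := @quad_argmin _ (Rk k) (lambda / 2 * Rk' k) (Dk k) (xi k.+1).
    by move=> t; rewrite /= -!sdE; exact: xi_opt.
  split=> //; rewrite {1}/Rk /round_risk round_ridgeS sdE cE; ring.
split=> k.
- have [_ D0 ->] := stepP k.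
  by rewrite gerBl mulr_ge0// sqr_ge0.
- exact: (@ex_derive _ _ _ _ _ _ _ (dR k)).
- have [cE _ ->] := stepP k => D0.
  have xiE : xi k.+1 = - (lambda / 2) * (Rk' k / Dk k).
    by rewrite mulrA mulNr cE opprK mulfK// gt_eqF.
  split=> //; rewrite xiE; field; exact: lt0r_neq0.
- have [cE D0 ->] := stepP k => R'0.
  have l2 : 0 < lambda / 2 by rewrite divr_gt0.
  have : xi k.+1 * Dk k != 0 by rewrite -oppr_eq0 -cE mulf_neq0 // lt0r_neq0.
  rewrite mulf_eq0 negb_or => /andP[xi0 Dn0].
  have {Dn0}D0 : 0 < Dk k by rewrite lt_def Dn0.
  split; first by rewrite gtrBl mulr_gt0// exprn_even_gt0.
  have := congr1 Num.sg cE.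
  rewrite sgrN (sgrM (lambda / 2)) (sgrM (xi _)) (gtr0_sg l2) (gtr0_sg D0).
  by rewrite mul1r mulr1 => ->; rewrite opprK.
Qed.
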